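(* Let $\mathcal{H}$ be a complex Hilbert space, let $T$ be a bounded linear operator on $\mathcal{H}$, let $n\in\mathbb{N}$, and let $\lambda=(\lambda_1,\dots,\lambda_n)\in\mathbb{C}^n$ be a pseudocorner of the closure $\overline{\mathcal{W}_n(T)}$ of $\mathcal{W}_n(T)$ in $\mathbb{C}^n$. Then each $\lambda_j$ ($1\leq j\leq n$) is an approximate eigenvalue of $T$.
   Context: $\mathbb{N}$ is the set of positive integers. For a bounded linear operator $T$ on $\mathcal{H}$ (with domain $\mathcal{H}$) and $n\in\mathbb{N}$, $\mathcal{E}(n,T)$ denotes the set of (ordered) orthonormal systems $\mathbf{e}=\{e_1,\dots,e_n\}$ in $\mathcal{H}$. For $\mathbf{e}\in\mathcal{E}(n,T)$ put $\tau(T,\mathbf{e})=(\langle Te_1,e_1\rangle,\dots,\langle Te_n,e_n\rangle)\in\mathbb{C}^n$. The $n$-dimensional numerical range of $T$ is $\mathcal{W}_n(T)=\{\tau(T,\mathbf{e}):\mathbf{e}\in\mathcal{E}(n,T)\}\subseteq\mathbb{C}^n$. Let $\Lambda\subset\mathbb{C}^n$ and $u\in\Lambda$. The point $u$ is a pseudocorner of $\Lambda$ if there are no real $a>0$ and $\varphi\in C^1([-a,a],\mathbb{C}^n)$ (continuously differentiable function of a real variable) such that $\varphi([-a,a])\subseteq\Lambda$, $\varphi(0)=u$ and $\varphi'(0)\neq 0$. A number $\mu\in\mathbb{C}$ is an approximate eigenvalue of $T$ if there is a sequence of vectors $x_m\in\mathcal{H}$ with $\|x_m\|=1$ and $\|Tx_m-\mu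 x_m\|\to 0$ as $m\to\infty$. *)

(* Defs.v *)
From HB Require Import structures.
From mathcomp Require Import all_boot all_order all_algebra.
From mathcomp Require Import complex.
From mathcomp Require Import all_classical all_reals all_analysis.

Set Implicit Arguments.
Unset Strict Implicit.
Unset Printing Implicit Defensive.

Import Order.TTheory GRing.Theory Num.Theory.
Import numFieldNormedType.Exports.

Local Open Scope classical_set_scope.
Local Open Scope ring_scope.
Local Open Scope complex_scope.

(* The library puts the norm topology on [R[i]^o]; transporting it to [R[i]]
   makes ['rV[R[i]]_n] carry the usual topology of C^n. *)
HB.instance Definition _ (R : realType) := NormedModule.copy R[i] R[i]^o.

Section numerical_range.
Context (R : realType) (H : completeNormedModType R[i]).

(* [{dot H for Num.conj}] is linear in the first variable, conjugate-linear in the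
   second, Hermitian and positive definite. *)
Definition hilbert_dot (dot : {dot H for Num.conj}) :=
  forall x : H, `|x| = sqrtC (dot x x).

Definition bounded_operator (T : {linear H -> H}) :=
  exists M : R, forall x : H, `|T x| <= M%:C * `|x|.

Definition orthonormal_system (dot : {dot H for Num.conj}) n (e : 'I_n -> H) :=
  forall j k, dot (e j) (e k) = (j == k)%:R.

Definition numerical_range (dot : {dot H for Num.conj}) (T : H -> H) n :
    set 'rV[R[i]]_n :=
  [set \row_j dot (T (e j)) (e j) | e in @orthonormal_system dot n].

Definition approximate_eigenvalue (T : H -> H) (mu : R[i]) :=
  exists x : nat -> H, (forall m, `|x m| = 1) /\
    `|T (x m) - mu *: x m| @[m --> \oo] --> (0 : R[i]).

End numerical_range.

Section pseudocorner.
Context (R : realType) (n : nat).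

(* [dphi] is the derivative of [phi] on [I], both real-variable: at an end point
   of an interval [I] the derivative is one-sided. *)
Definition derivative_on (I : set R) (phi dphi : R -> 'rV[R[i]]_n) :=
  forall t, I t ->
    ((s - t)^-1)%:C *: (phi s - phi t) @[s --> within I t^'] --> dphi t.

(* [phi] is C^1 on [I] with derivative [dphi]; the values outside [I] are
   irrelevant. *)
Definition C1_on (I : set R) (phi dphi : R -> 'rV[R[i]]_n) :=
  derivative_on I phi dphi /\ {within I, continuous dphi}.

Definition pseudocorner (L : set 'rV[R[i]]_n) (u : 'rV[R[i]]_n) :=
  L u /\
  ~ exists (a : R) (phi dphi : R -> 'rV[R[i]]_n),
      [/\ 0 < a, C1_on `[- a, a] phi dphi, phi @` `[- a, a] `<=` L,
          phi 0 = u & dphi 0 != 0].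

End pseudocorner.

(* Main.v *)
Require Import Defs.
From HB Require Import structures.
From mathcomp Require Import all_boot all_order all_algebra.
From mathcomp Require Import complex.
From mathcomp Require Import all_classical all_reals all_analysis.
From mathcomp Require Import ring.

Set Implicit Arguments.
Unset Strict Implicit.
Unset Printing Implicit Defensive.

Import Order.TTheory GRing.Theory Num.Theory.
Import numFieldNormedType.Exports.

(** Write [mu] for the [j]-th entry of [lambda] and suppose that it is not an
    approximate eigenvalue, so that [T x - mu x] is bounded away from [0] on
    the unit sphere.  Let [e] be an orthonormal system whose tuple of values
    [<T e_k, e_k>] is close to [lambda].  As [<T e_j, e_j>] is close to [mu],
    the vector [T e_j] must have a component of definite size orthogonal to
    [e_j]: there is a unit vector [f], equal to some other [e_k] or orthogonal
    to the whole system, with [|<T e_j, f>| >= c], where [c] does not depend on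
    [e] ([large_coefficient]).

    Rotate [e_j] towards [f] in the plane that they span, after multiplying [f]
    by a unimodular [zeta]; if [f = e_k], this rotates [e_k] as well.  The
    system stays orthonormal.  In terms of the tangent [t] of the angle, its
    tuple of values runs along [u / (1 + t^2) + t w / (1 + t^2) +
    t^2 v / (1 + t^2)], where [u] is the initial tuple
    ([numerical_range_rotation]).  The velocity at [t = 0] is [w], and
    [w_j = conj zeta <T e_j, f> + zeta <T f, e_j>] has modulus at least [c] for
    [zeta = 1] or [zeta = i] ([exists_phase]).

    Hence for a sequence of systems with [u_m] tending to [lambda] these curves
    all lie in the numerical range, and each is determined by three vectors of
    [C^n] that are bounded uniformly in [m].  Along an ultrafilter the vectors
    converge, so the curves converge pointwise to a curve of the same form.  It
    lies in the closure of the numerical range, is C^1, passes through [lambda]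
    and has nonzero velocity there, which a pseudocorner excludes
    ([not_pseudocorner_closure]). *)

Local Open Scope classical_set_scope.
Local Open Scope ring_scope.
Local Open Scope complex_scope.

(** * Limits of complex numbers and of rows *)

Section complex_limits.
Context (R : realType).

Lemma norm_real_complex (x : R) : `|x%:C| = (`|x|)%:C.
Proof. by rewrite normc_def /= expr0n addr0 sqrtr_sqr. Qed.

Lemma cvg_real_complex (T : Type) (F : set_system T) {FF : Filter F}
    (f : T -> R) (l : R) :
  f @ F --> l -> (f x)%:C @[x --> F] --> l%:C.
Proof.
move=> fl; apply/cvgrPdist_lt => e e0.
have eR : e = (complex.Re e)%:C by rewrite RRe_real // gtr0_real.
move/cvgrPdist_lt : fl => /(_ (complex.Re e)) fl.
have {}fl := fl _; rewrite eR ltcR in e0; move: (fl e0).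
apply: filterS => x; rewrite eR -rmorphB norm_real_complex ltcR //.
Qed.

(** An ultrafilter contains each set or its complement, so a cluster point,
    which compactness of [[-M, M]] provides, is a limit. *)
Lemma ultra_cvg_real (T : Type) (F : set_system T) {FF : UltraFilter F}
    (f : T -> R) (M : R) :
  (forall x, `|f x| <= M) -> exists l : R, f @ F --> l.
Proof.
move=> fM.
have FM : F (f @^-1` `[- M, M]).
  by apply: filterS filterT => x _; rewrite /= in_itv /= -ler_norml.
have [l [_ cl]] := @segment_compact R (- M) M (f @ F) _ FM.
exists l => N lN.
have [//|FN] := in_ultra_setVsetC (f @^-1` N) FF.
by have [y []] := cl (~` N) N FN lN.
Qed.

Lemma ultra_cvg_complex (T : Type) (F : set_system T) {FF : UltraFilter F}
    (f : T -> R[i]) (M : R) :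
  (forall x, `|f x| <= M%:C) -> exists l : R[i], f @ F --> l.
Proof.
move=> fM.
have [a fa] : exists l : R, complex.Re (f x) @[x --> F] --> l.
  apply: (@ultra_cvg_real _ _ FF _ M) => x.
  have := le_trans (normc_ge_Re (f x)) (fM x).
  by rewrite ?norm_real_complex lecR.
have [b fb] : exists l : R, complex.Im (f x) @[x --> F] --> l.
  apply: (@ultra_cvg_real _ _ FF _ M) => x.
  have i1 : `|'i%C : R[i]| = 1.
    by rewrite normc_def /= expr0n expr1n add0r sqrtr1.
  have := normc_ge_Re (f x * 'i%C).
  rewrite ReiNIm normrN normrM i1 mulr1 => /le_trans/(_ (fM x)).
  by rewrite ?norm_real_complex lecR.
exists (a%:C + 'i%C * b%:C).
rewrite (_ : f = fun x =>
  (complex.Re (f x))%:C + 'i%C * (complex.Im (f x))%:C); last first.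
  by apply: funext => x; rewrite -complexE.
apply: cvgD; first exact: cvg_real_complex.
by apply: cvgMl_tmp; exact: cvg_real_complex.
Qed.

Lemma cvg_row (T : Type) n (F : set_system T) {FF : Filter F}
    (f : T -> 'rV[R[i]]_n) (l : 'rV[R[i]]_n) :
  (forall k, f x 0 k @[x --> F] --> l 0 k) -> f @ F --> l.
Proof.
move=> fl; apply/cvg_ballP => e e0.
have : \forall x \near F, forall k, ball (l 0 k) e (f x 0 k).
  apply: filter_forall => k; exact: (cvg_ball (fl k)).
by apply: filterS => x Hx; split=> // i k; rewrite ord1.
Qed.

End complex_limits.

(** * The curve of values along a rotation *)

Section rotation_curve.
Context (R : realType).

(** [cos2_atan t] is the square of the cosine of [atan t]; in the same way
    [t * cos2_atan t] is the product of its sine and its cosine. *)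
Definition cos2_atan (t : R) : R := (1 + t ^+ 2)^-1.

(** With [theta = atan t] this is [cos^2 theta u + sin^2 theta v +
    sin theta cos theta w], where [1 - cos^2] stands for [sin^2].  The tangent
    as parameter makes the curve rational, and its difference quotients have a
    closed form. *)
Definition rotation_curve n (u v w : 'rV[R[i]]_n) (t : R) : 'rV[R[i]]_n :=
  v + (cos2_atan t)%:C *: (u - v) + (t * cos2_atan t)%:C *: w.

Definition rotation_velocity n (u v w : 'rV[R[i]]_n) (t : R) : 'rV[R[i]]_n :=
  (- (t + t) * (cos2_atan t * cos2_atan t))%:C *: (u - v) +
  ((1 - t * t) * (cos2_atan t * cos2_atan t))%:C *: w.

Lemma onePsqr_neq0 (t : R) : 1 + t ^+ 2 != 0.
Proof. by rewrite gt_eqF// ltr_pwDl // sqr_ge0. Qed.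

Lemma continuous_cos2_atan : continuous cos2_atan.
Proof.
move=> t; apply: cvgV; first exact: onePsqr_neq0.
apply: cvgD; first exact: cvg_cst.
exact: (@exprn_continuous R 2 t).
Qed.

Lemma cvg_rotation_curve (T : Type) n (F : set_system T) {FF : Filter F}
    (u v w : T -> 'rV[R[i]]_n) (a b c : 'rV[R[i]]_n) t :
  u @ F --> a -> v @ F --> b -> w @ F --> c ->
  rotation_curve (u x) (v x) (w x) t @[x --> F] --> rotation_curve a b c t.
Proof.
move=> ua vb wc; rewrite /rotation_curve; apply: cvgD.
  apply: cvgD; first exact: vb.
  apply: (@cvgZl_tmp _ _ _ _ _ _ (fun x => u x - v x)).
  by apply: cvgB; [exact: ua|exact: vb].
exact: (@cvgZl_tmp _ _ _ _ _ _ w).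
Qed.

(** The quotient [(rotation_curve s - rotation_curve t) / (s - t)] simplifies to
    an expression [g s] that is still defined and continuous at [s = t], where
    it takes the value [rotation_velocity t]. *)
Lemma rotation_curveC1 n (u v w : 'rV[R[i]]_n) (I : set R) :
  C1_on I (rotation_curve u v w) (rotation_velocity u v w).
Proof.
split.
  move=> t It.
  pose g s := (- (s + t) * (cos2_atan s * cos2_atan t))%:C *: (u - v) +
    ((1 - s * t) * (cos2_atan s * cos2_atan t))%:C *: w.
  rewrite -[rotation_velocity u v w t]/(g t).
  have gc : g s @[s --> t] --> g t.
    apply: cvgD; apply: cvgZr_tmp; apply: cvg_real_complex.
      apply: cvgM.
        by apply: cvgN; apply: cvgD; [exact: cvg_id|exact: cvg_cst].
      by apply: cvgM; [exact: continuous_cos2_atan|exact: cvg_cst].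
    apply: cvgM.
      apply: cvgB; first exact: cvg_cst.
      by apply: cvgM; [exact: cvg_id|exact: cvg_cst].
    by apply: cvgM; [exact: continuous_cos2_atan|exact: cvg_cst].
  have gw : g s @[s --> within I t^'] --> g t.
    apply: cvg_trans gc; apply: cvg_app.
    apply: (cvg_trans (cvg_within _)); exact: cvg_within.
  apply: cvg_trans gw; apply: near_eq_cvg.
  near=> s.
  have st : s - t != 0.
    rewrite subr_eq0; near: s.
    by apply: cvg_within; exact: withinT.
  rewrite /g /rotation_curve.
  apply/rowP => k; rewrite !mxE.
  have {}st : (s - t)%:C != 0 by rewrite (fmorph_eq0 (real_complex R)).
  have hs : (1 + s ^+ 2)%:C != 0.
    by rewrite (fmorph_eq0 (real_complex R)) onePsqr_neq0.
  have ht : (1 + t ^+ 2)%:C != 0.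
    by rewrite (fmorph_eq0 (real_complex R)) onePsqr_neq0.
  rewrite /cos2_atan !(rmorphM, fmorphV, rmorphN, rmorphD, rmorphB, rmorphXn,
    rmorph1) /= in st hs ht *.
  by field; rewrite st hs ht.
apply: continuous_subspaceT => t; rewrite /rotation_velocity /continuous_at.
have bb : cos2_atan s * cos2_atan s @[s --> t] --> cos2_atan t * cos2_atan t.
  by apply: cvgM; exact: continuous_cos2_atan.
apply: cvgD; apply: cvgZr_tmp; apply: cvg_real_complex.
  by apply: cvgM bb; apply: cvgN; apply: cvgD; exact: cvg_id.
apply: cvgM bb; apply: cvgB; first exact: cvg_cst.
by apply: cvgM; exact: cvg_id.
Unshelve. all: by end_near. Qed.

End rotation_curve.

(** * Rotating an orthonormal system *)

Section rotation.
Context (R : realType) (H : completeNormedModType R[i]).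
Context (dot : {dot H for Num.conj}).

Lemma dotC u v : dot u v = (dot v u)^*%R.
Proof. by rewrite hermC expr0 mul1r. Qed.

Lemma dotZl a u v : dot (a *: u) v = a * dot u v.
Proof. by rewrite linearZl_LR. Qed.

Lemma dotZr a u v : dot u (a *: v) = a^*%R * dot u v.
Proof. by rewrite linearZr_LR. Qed.

Lemma dotDl u v x : dot (u + v) x = dot u x + dot v x.
Proof. exact: linearDl. Qed.

Lemma dotDr u v x : dot x (u + v) = dot x u + dot x v.
Proof. exact: linearDr. Qed.

Lemma dotBl u v x : dot (u - v) x = dot u x - dot v x.
Proof. exact: linearBl. Qed.

Lemma dotBr u v x : dot x (u - v) = dot x u - dot x v.
Proof. exact: linearBr. Qed.

Lemma conjC_real_complex (t : R) : (t%:C)^*%R = t%:C.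
Proof. by rewrite conj_Creal //; apply/complex_realP; exists t. Qed.

(** Replace [e j] by [(e j + t zeta f) / sqrt (1 + t^2)] and, if some other
    [e k] is [f], replace it by [(f - t conj(zeta) e j) / sqrt (1 + t^2)].  This
    is a rotation of the plane of [e j] and [f], so the new system is
    orthonormal, and its values expand to a quadratic polynomial in [t] over
    [1 + t^2].  Here [dot (e k) f == 0] tests whether [e k] differs from [f]. *)
Lemma numerical_range_rotation (T : {linear H -> H}) n (e : 'I_n -> H) j f
    (zeta : R[i]) :
 orthonormal_system dot e -> dot f f = 1 -> dot (e j) f = 0 ->
 (forall k, dot (e k) f = 0 \/ e k = f) -> `|zeta| = 1 ->
 let z := zeta^*%R * dot (T (e j)) f + zeta * dot (T f) (e j) in
 let u := \row_k dot (T (e k)) (e k) in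
 let v := \row_k if k == j then dot (T f) f else
    if dot (e k) f == 0 then dot (T (e k)) (e k) else dot (T (e j)) (e j) in
 let w := \row_k if k == j then z else if dot (e k) f == 0 then 0 else - z in
 forall t, numerical_range dot T (rotation_curve u v w t).
Proof.
move=> ee ff ejf ef zeta1 z u v w t.
pose s := (Num.sqrt (cos2_atan t))%:C.
pose a := s *: (e j + (t%:C * zeta) *: f).
pose b := s *: (f - (t%:C * zeta^*%R) *: e j).
pose e' k := if k == j then a else if dot (e k) f == 0 then e k else b.
have zz : zeta * zeta^*%R = 1 by rewrite -normCK zeta1 expr1n.
have fej : dot f (e j) = 0 by rewrite dotC ejf conjC0.
have ejej : dot (e j) (e j) = 1 by rewrite ee eqxx.
have ss : s * s = (cos2_atan t)%:C.
  by rewrite /s -rmorphM -expr2 sqr_sqrtr // invr_ge0 addr_ge0 // sqr_ge0.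
have bt : (cos2_atan t)%:C * (1 + t%:C * t%:C) = 1.
  rewrite -(rmorph1 (real_complex R)) -rmorphM -rmorphD -rmorphM -expr2.
  by rewrite mulVf // onePsqr_neq0.
have sr : s^*%R = s by exact: conjC_real_complex.
have aa : dot a a = 1.
  rewrite /a !dotZl !dotZr !dotDl !dotDr /= !dotZl !dotZr ejf fej ff ejej sr.
  rewrite rmorphM /= conjC_real_complex.
  transitivity (s * s * (1 + t%:C * t%:C * (zeta * zeta^*%R))); first by ring.
  by rewrite zz mulr1 ss.
have bb : dot b b = 1.
  rewrite /b !dotZl !dotZr !dotBl !dotBr /= !dotZl !dotZr ejf fej ff ejej sr.
  rewrite rmorphM /= conjC_real_complex conjCK.
  transitivity (s * s * (1 + t%:C * t%:C * (zeta * zeta^*%R))); first by ring.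
  by rewrite zz mulr1 ss.
have ab : dot a b = 0.
  rewrite /b !dotZl !dotZr !dotDl !dotBr /= !dotZl !dotZr ejf fej ff ejej sr.
  rewrite rmorphM /= conjC_real_complex conjCK; ring.
have ba : dot b a = 0 by rewrite dotC ab conjC0.
(* the vectors of [e] other than [e j] and [f] are orthogonal to both, hence
   to the rotated vectors *)
have eja k : k != j -> dot (e k) f = 0 -> dot (e k) a = 0.
  by move=> kj kf; rewrite dotZr linearDr /= dotZr kf ee (negPf kj) !(mulr0,addr0).
have ejb k : k != j -> dot (e k) f = 0 -> dot (e k) b = 0.
  by move=> kj kf; rewrite dotZr linearBr /= dotZr kf ee (negPf kj) !(mulr0,subr0).
exists e'.
  move=> k l; rewrite /e'.
  case: (boolP (k == j)) => kj; case: (boolP (l == j)) => lj.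
  - by rewrite (eqP kj) (eqP lj) eqxx.
  - rewrite (eqP kj) [j == l]eq_sym (negPf lj); case: eqP => [lf|//].
    by rewrite dotC eja // conjC0.
  - by rewrite (eqP lj) (negPf kj); case: eqP => [kf|//]; rewrite eja.
  - case: (eqVneq (dot (e k) f) 0) => kf; case: (eqVneq (dot (e l) f) 0) => lf.
    + exact: ee.
    + have [kl|kl] := eqVneq k l; last by rewrite ejb.
      by move: lf; rewrite -kl kf eqxx.
    + have [kl|kl] := eqVneq k l; first by move: kf; rewrite kl lf eqxx.
      by rewrite dotC ejb // conjC0.
    + have -> : k = l.
        have ek : e k = f by case: (ef k) kf => // ->; rewrite eqxx.
        have el : e l = f by case: (ef l) lf => // ->; rewrite eqxx.
        apply/eqP/negPn/negP => kl; have := ee k l.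
        by rewrite ek el ff (negPf kl) => /eqP; rewrite oner_eq0.
      by rewrite bb eqxx.
apply/rowP => k; rewrite /e' !mxE.
have curve (p q r : R[i]) :
    q + (cos2_atan t)%:C * (p - q) + (t * cos2_atan t)%:C * r =
    (cos2_atan t)%:C * (p + t%:C * r + t%:C * t%:C * q).
  rewrite rmorphM /= -{1}[q]mul1r -bt; ring.
case: ifP => [/eqP kj|kj].
  rewrite curve kj /z /a (linearZ_LR T) (linearD T) (linearZ_LR T) /=.
  rewrite !dotZl !dotZr !dotDl !dotDr /= !dotZl !dotZr.
  rewrite sr rmorphM /= conjC_real_complex -ss.
  rewrite -[dot (T f) f in RHS]mul1r -zz; ring.
case: ifP => kf; first by rewrite subrr !mulr0 !addr0.
have ek : e k = f by case: (ef k) => // k0; rewrite k0 eqxx in kf.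
rewrite curve ek /z /b (linearZ_LR T) (linearB T) (linearZ_LR T) /=.
rewrite !dotZl !dotZr !dotBl !dotBr /= !dotZl !dotZr.
rewrite sr rmorphM /= conjC_real_complex conjCK -ss.
rewrite -[dot (T (e j)) (e j) in RHS]mul1r -zz; ring.
Qed.

(** For [zeta = 1] and [zeta = i] the right-hand side is [|x + y|] and
    [|x - y|], and these cannot both be smaller than [|x|] as
    [2x = (x + y) + (x - y)]. *)
Lemma exists_phase (x y : R[i]) :
  exists2 zeta : R[i], `|zeta| = 1 & `|x| <= `|zeta^*%R * x + zeta * y|.
Proof.
have [xy|xy] := real_leP (normr_real x) (normr_real (x + y)).
  by exists 1; rewrite ?normr1 // conjC1 !mul1r.
exists 'i; first exact: normCi.
rewrite conjCi (_ : _ + _ = 'i * (y - x)); last by rewrite mulNr mulrBr addrC.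
rewrite normrM normCi mul1r distrC.
have := ler_normD (x + y) (x - y).
rewrite (_ : x + y + (x - y) = x *+ 2) ?normrMn; last by ring.
rewrite mulr2n => h; rewrite -(lerD2l `|x|); apply: (le_trans h).
by rewrite lerD2r ltW.
Qed.

Context (hdot : hilbert_dot dot).

Lemma dot_normE u : dot u u = `|u| ^+ 2.
Proof. by rewrite hdot sqrtCK. Qed.

Lemma norm1_of_dot1 u : dot u u = 1 -> `|u| = 1.
Proof. by move=> uu; rewrite hdot uu sqrtC1. Qed.

(** Cauchy-Schwarz for a unit vector [v]: the vector [u - <u, v> v] has squared
    norm [|u|^2 - |<u, v>|^2]. *)
Lemma norm_dot_le u v : dot v v = 1 -> `|dot u v| <= `|u|.
Proof.
move=> v1.
rewrite -(@ler_pXn2r _ 2) ?nnegrE // -dot_normE -subr_ge0.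
have := dnorm_ge0 dot (u - dot u v *: v).
rewrite dnormB dnormZ v1 mulr1 dotZr /=.
rewrite -!normCKC (CrealP (rpredX 2 (normr_real _))).
by congr (_ <= _); ring.
Qed.

(** Expand [x - mu e_j] as [(<x, e_j> - mu) e_j], plus the [<x, e_k> e_k] for
    [k != j], plus a rest [g] orthogonal to the system.  If no [<x, e_k>] with
    [k != j] reaches [c], the first two parts have norm at most [(n + 1) c], so
    that [|g| >= c] and [f = g / |g|] satisfies [<x, f> = |g|]. *)
Lemma large_coefficient n (e : 'I_n -> H) j x mu (c : R[i]) :
  orthonormal_system dot e -> 0 < c ->
  `|dot x (e j) - mu| < c -> n.+2%:R * c <= `|x - mu *: e j| ->
  exists f, [/\ dot f f = 1, dot (e j) f = 0,
    forall k, dot (e k) f = 0 \/ e k = f & c <= `|dot x f|].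
Proof.
move=> ee c0 xj xmu.
have [[k [kj ck]]|small] := pselect (exists k, k != j /\ c <= `|dot x (e k)|).
  exists (e k); split => //; first by rewrite ee eqxx.
    by rewrite ee eq_sym (negPf kj).
  by move=> l; rewrite ee; have [->|_] := eqVneq l k; [right|left].
have {}small k : k != j -> `|dot x (e k)| <= c.
  move=> kj.
  have [//|/ltW ck] := real_leP (normr_real (dot x (e k))) (gtr0_real c0).
  by case: small; exists k.
pose g := x - \sum_k dot x (e k) *: e k.
have ge k : dot g (e k) = 0.
  rewrite linearBl /= linear_sumlz (bigD1 k) //= big1 => [|l lk].
    by rewrite dotZl ee eqxx mulr1 addr0 subrr.
  by rewrite dotZl ee (negPf lk) mulr0.
have cg : c <= `|g|.
  have : `|x - mu *: e j| <= c + (n%:R * c + `|g|).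
    rewrite (_ : x - _ = (dot x (e j) - mu) *: e j +
      (\sum_(k | k != j) dot x (e k) *: e k + g)); last first.
      have -> : g = x - (dot x (e j) *: e j + \sum_(k | k != j) dot x (e k) *: e k).
        by rewrite /g (bigD1 j).
      rewrite scalerBl opprD; set S := \sum_(k | _) _.
      by rewrite [S + _]addrCA [S + _]addrCA subrr addr0 [RHS]addrC addrA subrK.
    have e1 k : `|e k| = 1 by apply: norm1_of_dot1; rewrite ee eqxx.
    apply: (le_trans (ler_normD _ _)); apply: lerD.
      by rewrite normrZ e1 mulr1 ltW.
    apply: (le_trans (ler_normD _ _)); rewrite lerD2r.
    apply: (le_trans (ler_norm_sum _ _ _)).
    apply: (@le_trans _ _ (\sum_(k < n) c)); last first.
      by rewrite sumr_const card_ord mulr_natl.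
    rewrite [leRHS](bigID (fun k => k != j)) /= -[leLHS]addr0.
    apply: lerD; last by apply: sumr_ge0 => *; exact: ltW.
    by apply: ler_sum => k kj; rewrite normrZ e1 mulr1 small.
  move/(le_trans xmu); rewrite -addn2 natrD mulrDl addrA [c + _]addrC -addrA lerD2l.
  by rewrite mulr_natl mulr2n lerD2l.
have g0 : 0 < `|g| := lt_le_trans c0 cg.
have gg : dot g g = `|g| ^+ 2 := dot_normE g.
have eg k : dot (e k) g = 0 by rewrite dotC ge conjC0.
have gr : (`|g|^-1)^*%R = `|g|^-1 by rewrite conj_Creal // rpredV normr_real.
have xg : dot x g = `|g| ^+ 2.
  rewrite -gg -[x in LHS](subrK (\sum_k dot x (e k) *: e k)) -/g linearDl /=.
  rewrite linear_sumlz /=.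
  by rewrite big1 ?addr0 // => k _; rewrite dotZl eg mulr0.
exists (`|g|^-1 *: g); split.
- by rewrite dotZl dotZr gr gg expr2 mulrA; field; rewrite gt_eqF.
- by rewrite dotZr eg mulr0.
- by move=> k; left; rewrite dotZr eg mulr0.
- by rewrite dotZr gr xg expr2 mulrA mulVf ?gt_eqF // mul1r ger0_norm.
Qed.

End rotation.

(** * Passage to the limit *)

Section limit.
Context (R : realType).

Lemma cvg_natSinv (x : R) n (u : nat -> 'rV[R[i]]_n) l :
  0 < x -> (forall m, ball l (x / m.+1%:R)%:C (u m)) -> u @ \oo --> l.
Proof.
move=> x0 ul; apply/cvg_ballP => e e0.
have eR : e = (complex.Re e)%:C by rewrite RRe_real // gtr0_real.
rewrite eR ltcR in e0.
have xe : 0 < complex.Re e / x by rewrite divr_gt0.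
near=> m; apply: le_ball (ul m).
rewrite eR lecR mulrC -ler_pdivlMr //; apply: ltW.
by near: m; exact: (near_infty_natSinv_lt (PosNum xe)).
Unshelve. all: by end_near. Qed.

(** The limits of [v] and [w] along an ultrafilter define the curve that a
    pseudocorner forbids: each of its points is a limit of points of [L], and
    its velocity at [0] is the limit of [w], of [j]-th modulus at least [c]. *)
Lemma not_pseudocorner_closure n (L : set 'rV[R[i]]_n) (lambda : 'rV[R[i]]_n)
    (u v w : nat -> 'rV[R[i]]_n) (M : R) (c : R[i]) (j : 'I_n) :
  (forall m t, L (rotation_curve (u m) (v m) (w m) t)) ->
  u @ \oo --> lambda ->
  (forall m k, `|v m 0 k| <= M%:C) -> (forall m k, `|w m 0 k| <= M%:C) ->
  0 < c -> (forall m, c <= `|w m 0 j|) ->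
  ~ pseudocorner (closure L) lambda.
Proof.
move=> Lc ul vM wM c0 wc [_]; apply.
have [G [GU ooG]] := ultraFilterLemma (eventually_filter).
have {}ul : u @ G --> lambda by apply: cvg_trans ul; exact: cvg_app.
have bounded_cvg (x : nat -> 'rV[R[i]]_n) : (forall m k, `|x m 0 k| <= M%:C) ->
    exists l : 'rV[R[i]]_n, x @ G --> l.
  move=> xM.
  have /choice[l xl] : forall k : 'I_n, exists l : R[i], x m 0 k @[m --> G] --> l.
    by move=> k; apply: (@ultra_cvg_complex _ _ _ GU _ M) => m; exact: xM.
  by exists (\row_k l k); apply: cvg_row => k; rewrite mxE; exact: xl.
have [V vV] := bounded_cvg v vM.
have [W wW] := bounded_cvg w wM.
exists 1, (rotation_curve lambda V W), (rotation_velocity lambda V W); split.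
- exact: ltr01.
- exact: rotation_curveC1.
- move=> _ [t _ <-] B nB.
  have GB : \forall m \near G, B (rotation_curve (u m) (v m) (w m) t).
    exact: (cvg_rotation_curve ul vV wW).
  have [m Bm] := filter_ex GB.
  by exists (rotation_curve (u m) (v m) (w m) t).
- rewrite /rotation_curve /cos2_atan expr0n /= addr0 invr1 mul0r.
  by rewrite scale1r scale0r addr0 addrC subrK.
- rewrite /rotation_velocity /cos2_atan expr0n /= !addr0 invr1 oppr0 !mul0r subr0.
  rewrite !mul1r scale1r scale0r add0r.
  apply/eqP => W0.
  have GB : \forall m \near G, ball W c (w m) by exact: (cvg_ball wW).
  have [m [_ /(_ 0 j)]] := filter_ex GB.
  by rewrite W0 mxE /ball /= sub0r normrN => /(le_lt_trans (wc m)); rewrite ltxx.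
Qed.

End limit.

(** * Entries of a pseudocorner *)

Section approximate_eigenvalue.
Context (R : realType) (H : completeNormedModType R[i]).

Lemma not_approximate_eigenvalue (T : H -> H) (mu : R[i]) :
  ~ approximate_eigenvalue T mu ->
  exists2 d : R, 0 < d & forall x, `|x| = 1 -> d%:C <= `|T x - mu *: x|.
Proof.
move=> Tmu; apply: contrapT => nd; apply: Tmu.
have /choice[x xP] : forall m : nat, exists x : H,
    `|x| = 1 /\ `|T x - mu *: x| < (m.+1%:R^-1 : R)%:C.
  move=> m; apply: contrapT => nx; apply: nd; exists m.+1%:R^-1 => [|x x1].
    by rewrite invr_gt0.
  have rm : (m.+1%:R^-1 : R)%:C \is Num.real by apply/complex_realP; eexists.
  by have [//|lt] := real_leP rm (normr_real (T x - mu *: x)); case: nx; exists x.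
exists x; split=> [m|]; first by case: (xP m).
apply/cvgr0Pnorm_lt => e e0.
have eR : e = (complex.Re e)%:C by rewrite RRe_real // gtr0_real.
rewrite eR ltcR in e0.
near=> m; rewrite normr_id; apply: (lt_trans (xP m).2).
rewrite eR ltcR.
by near: m; exact: (near_infty_natSinv_lt (PosNum e0)).
Unshelve. all: by end_near. Qed.

End approximate_eigenvalue.

Local Close Scope complex_scope.

Theorem theorem1p2 (R : realType) (H : completeNormedModType R[i])
    (dot : {dot H for Num.conj}) (hdot : hilbert_dot dot)
    (T : {linear H -> H}) (hT : bounded_operator T)
    (n : nat) (hn : (0 < n)%N) (lambda : 'rV[R[i]]_n)
    (hlambda : pseudocorner (closure (@numerical_range R H dot T n)) lambda)
    (j : 'I_n) :
  approximate_eigenvalue T (lambda 0 j).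
Proof.
apply: contrapT => /not_approximate_eigenvalue[d d0 dT].
have [M TM] := hT.
pose c : R := d / n.+2%:R.
have c0 : 0 < c by rewrite divr_gt0.
(* [M] bounds the entries of [u] and [v], and [M + M] those of [w] *)
have dotM x y : dot x x = 1 -> dot y y = 1 -> `|dot (T x) y| <= M%:C%C.
  move=> xx yy; apply: (le_trans (norm_dot_le hdot _ yy)).
  by apply: (le_trans (TM x)); rewrite (norm1_of_dot1 hdot xx) mulr1.
(* [p] collects the tuple [u], the value [v] at the end of a quarter turn and
   the velocity [w] for a rotation from a system of values near [lambda] *)
suff /choice[uvw uvwP] : forall m : nat,
  exists p : 'rV[R[i]]_n * 'rV[R[i]]_n * 'rV[R[i]]_n,
  [/\ forall t, numerical_range dot T (rotation_curve p.1.1 p.1.2 p.2 t),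
      ball lambda (c / m.+1%:R)%:C%C p.1.1,
      forall k, `|p.1.2 0 k| <= (M + M)%:C%C,
      forall k, `|p.2 0 k| <= (M + M)%:C%C & c%:C%C <= `|p.2 0 j|].
  apply: (@not_pseudocorner_closure _ _ _ _ (fun m => (uvw m).1.1)
    (fun m => (uvw m).1.2) (fun m => (uvw m).2)
    (M + M) c%:C%C j _ _ _ _ _ _ hlambda).
  - by move=> m t; case: (uvwP m).
  - by apply: (cvg_natSinv c0) => m; case: (uvwP m).
  - by move=> m k; case: (uvwP m).
  - by move=> m k; case: (uvwP m).
  - by rewrite ltcR.
  - by move=> m; case: (uvwP m).
move=> m; have em0 : 0 < (c / m.+1%:R)%:C%C :> R[i] by rewrite ltcR divr_gt0.
have [u [[e ee <-] lu]] := hlambda.1 _ (nbhsx_ballx lambda _ em0).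
have e1 k : dot (e k) (e k) = 1 by rewrite ee eqxx.
(* the radius [c / (m + 1)] is at most [c] *)
have uj : `|dot (T (e j)) (e j) - lambda 0 j| < c%:C%C.
  have [_ /(_ 0 j)] := lu.
  rewrite mxE distrC /ball /= => /lt_le_trans; apply.
  by rewrite lecR ler_pdivrMr // ler_pMr // ler1n.
have dj : n.+2%:R * c%:C%C <= `|T (e j) - lambda 0 j *: e j|.
  apply: le_trans (dT _ (norm1_of_dot1 hdot (e1 j))).
  by rewrite -(rmorph_nat (real_complex R)) -rmorphM lecR mulrC divfK.
have cC0 : 0 < c%:C%C :> R[i] by rewrite ltcR.
have [f [ff ejf ef cf]] := large_coefficient hdot ee cC0 uj dj.
have [zeta zeta1 zc] := exists_phase (dot (T (e j)) f) (dot (T f) (e j)).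
have M0 : 0 <= M%:C%C :> R[i] := le_trans (normr_ge0 _) (dotM _ _ ff ff).
have MMC : (M + M)%:C%C = M%:C%C + M%:C%C :> R[i] by rewrite rmorphD.
have zM : `|zeta^* * dot (T (e j)) f + zeta * dot (T f) (e j)| <= (M + M)%:C%C.
  rewrite MMC; apply: (le_trans (ler_normD _ _)).
  by rewrite !normrM norm_conjC zeta1 !mul1r lerD // dotM.
have Mle (x : R[i]) : `|x| <= M%:C%C -> `|x| <= (M + M)%:C%C.
  by move=> xM; rewrite MMC; apply: (le_trans xM); rewrite lerDl.
refine (ex_intro _ (_, _, _) _); split=> /=.
- exact: numerical_range_rotation ee ff ejf ef zeta1.
- exact: lu.
- by move=> k; rewrite mxE; do 2?case: ifP => _; apply: Mle; exact: dotM.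
- move=> k; rewrite mxE; do 2?case: ifP => _; rewrite ?normrN //.
  by rewrite normr0 MMC addr_ge0.
- by rewrite mxE eqxx; exact: le_trans zc.
Qed.
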